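(* Let $n\geq 1$, let $Q_{n-1}$ be a polynomial of degree at most $n-1$ satisfying conditions (i) and (ii) of the context, with nodes $x_{n,k}$, and let $R_n$ be the associated rational Bernstein operator. Put $\Delta_n=\sup_{0\leq k\leq n-1}|x_{n,k+1}-x_{n,k}|$. Then for all $x\in[0,1]$, $$R_n\left[(e_1-x)^4\right](x)\leq\Delta_n\cdot R_n\left[(e_1-x)^2\right](x)\cdot\left(6x^2-15x+12+\Delta_n\right).$$
   Context: $C[0,1]$ is the space of continuous real-valued functions on $[0,1]$. For fixed $x$, $R_n[(e_1-x)^r](x)$ denotes the value at $x$ of $R_n$ applied to the function $t\mapsto(t-x)^r$. Let $n\geq 1$ and let $Q_{n-1}$ be a polynomial of degree at most $n-1$, strictly positive on $[0,1]$. Write $Q_{n-1}(x)=\sum_{k=0}^{n-1}\gamma_{n-1,k}\,x^k(1-x)^{n-1-k}$ and $\gamma_{n-1,k}=w_{n-1,k}\binom{n-1}{k}$, so that the $w_{n-1,k}$ are the Bernstein coefficients of $Q_{n-1}$. Conditions: (i) $w_{n-1,k}>0$ for $k=0,\dots,n-1$; (ii) property (W): $\frac{w_{n-1,k-1}w_{n-1,k+1}}{w_{n-1,k}^2}<\frac{k+1}{k}\cdot\frac{n-k}{n-k-1}$ for $k=1,\dots,n-2$ (equivalently, $\gamma_{n-1,k-1}/\gamma_{n-1,k}$ is strictly increasing in $k=1,\dots,n-1$). Convention: $\gamma_{n-1,-1}=\gamma_{n-1,n}=0$. The nodes are $x_{n,k}=\frac{\gamma_{n-1,k-1}}{\gamma_{n-1,k}+\gamma_{n-1,k-1}}$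 for $k=0,\dots,n$; under (i) and (ii) one has $0=x_{n,0}<x_{n,1}<\dots<x_{n,n}=1$. The rational Bernstein operator associated with $Q_{n-1}$ is $$R_nf(x)=\sum_{k=0}^{n}f(x_{n,k})\,(\gamma_{n-1,k}+\gamma_{n-1,k-1})\,\frac{x^k(1-x)^{n-k}}{Q_{n-1}(x)},\qquad f\in C[0,1],$$ which reproduces the functions $1$ and $x$. *)

(* Defs.v *)
From mathcomp Require Import all_boot all_order all_algebra.
From mathcomp Require Import classical_sets reals.

Set Implicit Arguments.
Unset Strict Implicit.
Unset Printing Implicit Defensive.

Import Order.TTheory GRing.Theory Num.Theory.
Local Open Scope ring_scope.
Local Open Scope classical_set_scope.

Section RationalBernstein.
Variable R : realType.
Implicit Types (n k : nat) (w : nat -> R) (Q : {poly R}) (f : R -> R) (x : R).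

(* Only the values w 0, ..., w n.-1 matter: the binomial coefficient vanishes
   for k >= n when n >= 1. In particular gamma n w n = 0. *)
Definition gamma n w k : R := w k * 'C(n.-1, k)%:R.

(* gamma_{n-1,k-1}, with the convention gamma_{n-1,-1} = 0. *)
Definition gamma_prev n w k : R := if k is k'.+1 then gamma n w k' else 0.

Definition bernstein_coefs n Q w : Prop :=
  Q = \sum_(k < n) gamma n w k *: ('X ^+ k * (1 - 'X) ^+ (n - 1 - k)).

Definition property_W n w : Prop :=
  forall k, (1 <= k <= n - 2)%N ->
    w k.-1 * w k.+1 / w k ^+ 2
      < (k.+1%:R / k%:R) * ((n - k)%:R / (n - k - 1)%:R).

Definition node n w k : R :=
  gamma_prev n w k / (gamma n w k + gamma_prev n w k).

(* The operator only samples f at the nodes, so it is defined on all functions;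
   an element of C[0,1] may be extended arbitrarily outside [0,1]. *)
Definition rat_bernstein n Q w f x : R :=
  \sum_(k < n.+1) f (node n w k) * (gamma n w k + gamma_prev n w k)
    * (x ^+ k * (1 - x) ^+ (n - k) / Q.[x]).

Definition mesh n w : R :=
  sup [set `|node n w k.+1 - node n w k| | k in [set k | (0 <= k <= n - 1)%N]].

End RationalBernstein.

(* Main.v *)
Require Import Defs.
From mathcomp Require Import all_boot all_order all_algebra.
From mathcomp Require Import classical_sets reals.
From mathcomp Require Import ring lra.

Import Order.TTheory GRing.Theory Num.Theory.
Local Open Scope ring_scope.

(** Write $\gamma_k$, $x_k$ for the coefficients and nodes, and let
    $q_k = \gamma_k x^k (1-x)^{n-1-k} / Q(x) \ge 0$.  The identities
    $(\gamma_k + \gamma_{k-1}) x_k = \gamma_{k-1}$ and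
    $(\gamma_k + \gamma_{k-1}) (1 - x_k) = \gamma_k$ have two consequences.

    Firstly, the $k$-th term of $R_n[(e_1-x) g](x)$ is
    $x(1-x) g(x_k) (q_{k-1} - q_k)$, so that summation by parts gives
    $R_n[(e_1-x) g](x) = x(1-x) \sum_{k<n} q_k (g(x_{k+1}) - g(x_k))$
    ([rat_bernstein_mul_center]).  With $A = x_{k+1}-x$, $B = x_k-x$ and
    $d = x_{k+1}-x_k$, the second moment is $x(1-x) \sum q_k d$ and the fourth
    one is $x(1-x) \sum q_k d (3AB + d^2)$.  As $d \le \Delta$, what remains
    is to bound $\sum q_k d A B$ by $\Delta \sum q_k d$.

    Secondly, $q_{k+1} x_{k+1} (1-x) = q_k (1-x_{k+1}) x$, which makes
    $\sum q_k A B$ telescope into $\sum q_k d ((1-x) x_k - x A)$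
    ([sum_weighted_cross]): a sum of products becomes a sum of steps.  Now $AB$
    is negative only when $x$ lies between the two nodes, and then
    $AB \ge -x(1-x) d$; hence $d A B \le \Delta (AB + x(1-x) d)$ in all cases
    ([step_cross_le]).  Summing, and using
    $(1-x) x_k - xA + x(1-x) \le 1$, gives the bound
    ([sum_weighted_step_cross_le]).

    This proves the inequality with the factor $3 + \Delta$, which is at most
    $6x^2 - 15x + 12 + \Delta$ since
    $6x^2 - 15x + 9 = 3(1-x)(3-2x) \ge 0$ on $[0,1]$. *)

(** * Weighted sums over consecutive nodes *)

Section WeightedSums.
Variables (R : realFieldType) (x : R) (n : nat) (t q : nat -> R).
Hypothesis x01 : 0 <= x <= 1.
Hypothesis t_first : t 0%N = 0.
Hypothesis t_last : t n.+1 = 1.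
Hypothesis t01 : forall k, (k <= n.+1)%N -> 0 <= t k <= 1.
Hypothesis t_mono : forall k, (k <= n)%N -> t k <= t k.+1.
Hypothesis q_ge0 : forall k, (k <= n)%N -> 0 <= q k.
Hypothesis q_balance : forall k, (k < n)%N ->
  q k.+1 * t k.+1 * (1 - x) = q k * (1 - t k.+1) * x.

(** The difference of the two summands is $V_{k-1} - V_k$ for
    $V_k = q_k x (1 - t_{k+1}) (t_{k+1} - x)$: the balance relation is what
    turns $q_k (1-x) t_k (t_k - x)$ into $V_{k-1}$.  The boundary terms vanish
    because $t_0 = 0$ and $t_{n+1} = 1$. *)
Lemma sum_weighted_cross :
  \sum_(k < n.+1) q k * ((t k.+1 - x) * (t k - x)) =
  \sum_(k < n.+1)
    q k * ((t k.+1 - t k) * ((1 - x) * t k - x * (t k.+1 - x))).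
Proof.
apply/eqP; rewrite -subr_eq0 -sumrB; apply/eqP.
have part m : (m <= n)%N ->
  \sum_(k < m.+1) (q k * ((t k.+1 - x) * (t k - x)) -
    q k * ((t k.+1 - t k) * ((1 - x) * t k - x * (t k.+1 - x)))) =
  - (q m * (1 - t m.+1) * x * (t m.+1 - x)).
  elim: m => [|m IHm] le_mn; first by rewrite big_ord1 t_first; ring.
  by rewrite big_ord_recr /= IHm ?(ltnW le_mn) // -q_balance //; ring.
by rewrite part // t_last; ring.
Qed.

(** The shift by $x(1-x) d$ makes the right-hand factor nonnegative even when
    $x$ lies between the nodes $b \le a$, where
    $(a-x)(b-x) + x(1-x)(a-b)
      = (a-x)(1-x) b + x (x-b) (1-a)$. *)
Lemma step_cross_le (a b D : R) :
  0 <= b -> b <= a -> a <= 1 -> a - b <= D ->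
  (a - b) * ((a - x) * (b - x)) <=
  D * ((a - x) * (b - x) + x * (1 - x) * (a - b)).
Proof.
case/andP: x01 => x_ge0 x_le1 b_ge0 le_ba a_le1 le_D.
have d_ge0 : 0 <= a - b by rewrite subr_ge0.
have D_ge0 : 0 <= D by apply: le_trans le_D.
have shift_ge0 : 0 <= x * (1 - x) * (a - b).
  by rewrite !mulr_ge0 // subr_ge0.
have [cross_ge0|cross_lt0] := lerP 0 ((a - x) * (b - x)).
  apply: le_trans (_ : D * ((a - x) * (b - x)) <= _).
    exact: ler_wpM2r.
  by rewrite ler_wpM2l // lerDl.
have [x_le_b|b_lt_x] := lerP x b.
  by move: cross_lt0; rewrite ltNge mulr_ge0 ?subr_ge0 ?(le_trans x_le_b).
have [a_lt_x|x_le_a] := ltrP a x.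
  by move: cross_lt0; rewrite ltNge mulr_le0 // subr_le0 ltW.
apply: le_trans (_ : 0 <= _).
  by rewrite mulr_ge0_le0 // ltW.
have -> : (a - x) * (b - x) + x * (1 - x) * (a - b) =
    (a - x) * (1 - x) * b + x * (x - b) * (1 - a) by ring.
by rewrite mulr_ge0 // addr_ge0 // !mulr_ge0 // subr_ge0 // ltW.
Qed.

Lemma sum_weighted_step_cross_le (D : R) :
  (forall k, (k <= n)%N -> t k.+1 - t k <= D) ->
  \sum_(k < n.+1) q k * ((t k.+1 - t k) * ((t k.+1 - x) * (t k - x))) <=
  D * \sum_(k < n.+1) q k * (t k.+1 - t k).
Proof.
move=> step_le; case/andP: (x01) => x_ge0 x_le1.
have D_ge0 : 0 <= D.
  by apply: le_trans (step_le 0%N _) => //; rewrite subr_ge0 t_mono.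
apply: le_trans (_ : D * \sum_(k < n.+1)
  q k * ((t k.+1 - x) * (t k - x) + x * (1 - x) * (t k.+1 - t k)) <= _).
  rewrite mulr_sumr; apply: ler_sum => k _; rewrite [leRHS]mulrCA.
  have le_kn : (k <= n)%N by rewrite -ltnS.
  have /andP[tk_ge0 _] := t01 k (leqW le_kn).
  have /andP[_ tk1_le1] := t01 k.+1 le_kn.
  by rewrite ler_wpM2l ?q_ge0 // step_cross_le ?t_mono ?step_le.
apply: ler_wpM2l => //.
under eq_bigr => k _ do rewrite mulrDr.
rewrite big_split /= sum_weighted_cross -big_split /=.
apply: ler_sum => k _; rewrite -mulrDr.
have le_kn : (k <= n)%N by rewrite -ltnS.
have /andP[tk_ge0 tk_le1] := t01 k (leqW le_kn).
have le_t := t_mono k le_kn.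
rewrite ler_wpM2l ?q_ge0 // -subr_ge0.
(* Here 1 - ((1-x) b - x (a-x) + x (1-x)) is written, for the nodes b <= a, as a
   sum of terms that are visibly nonnegative. *)
have -> : t k.+1 - t k - ((t k.+1 - t k) * ((1 - x) * t k - x * (t k.+1 - x)) +
    x * (1 - x) * (t k.+1 - t k)) =
  (t k.+1 - t k) * (x * (t k.+1 - t k) + ((1 - x) * (1 - t k) + x * t k)).
  by ring.
have dk_ge0 : 0 <= t k.+1 - t k by rewrite subr_ge0.
by rewrite mulr_ge0 // !addr_ge0 // mulr_ge0 ?subr_ge0.
Qed.

(** $A^3 - B^3 = (A-B)(3AB + (A-B)^2)$ splits the increment of the cube into
    the part controlled by the preceding lemma and a part of size
    $\Delta^2 d$. *)
Lemma sum_weighted_cube_le (D : R) :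
  (forall k, (k <= n)%N -> t k.+1 - t k <= D) ->
  \sum_(k < n.+1) q k * ((t k.+1 - x) ^+ 3 - (t k - x) ^+ 3) <=
  D * (\sum_(k < n.+1) q k * (t k.+1 - t k)) * (3 + D).
Proof.
move=> step_le; set S := \sum_(k < n.+1) q k * (t k.+1 - t k).
have -> : D * S * (3 + D) = 3 * (D * S) + D ^+ 2 * S by ring.
apply: le_trans (lerD (ler_wpM2l (ler0n R 3)
  (sum_weighted_step_cross_le D step_le)) (lexx _)).
rewrite !mulr_sumr -big_split /=; apply: ler_sum => k _.
have le_kn : (k <= n)%N by rewrite -ltnS.
have d_ge0 : 0 <= t k.+1 - t k by rewrite subr_ge0 t_mono.
have q_d_ge0 : 0 <= q k * (t k.+1 - t k) by rewrite mulr_ge0 ?q_ge0.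
have -> : q k * ((t k.+1 - x) ^+ 3 - (t k - x) ^+ 3) =
  3 * (q k * ((t k.+1 - t k) * ((t k.+1 - x) * (t k - x)))) +
  (t k.+1 - t k) ^+ 2 * (q k * (t k.+1 - t k)) by ring.
by rewrite lerD2l ler_wpM2r // lerXn2r ?nnegrE ?step_le ?(le_trans d_ge0) ?step_le.
Qed.

End WeightedSums.

(** * Nodes and mesh *)

Section Nodes.
Variables (R : realType) (n : nat) (w : nat -> R).
Hypothesis n_gt0 : (0 < n)%N.
Hypothesis w_gt0 : forall k : nat, (k <= n - 1)%N -> 0 < w k.

Lemma gamma_gt0 k : (k < n)%N -> 0 < gamma n w k.
Proof.
move=> lt_kn; have le_k : (k <= n.-1)%N by rewrite -ltnS prednK.
by rewrite mulr_gt0 ?w_gt0 ?subn1 // ltr0n bin_gt0.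
Qed.

Lemma gamma_last : gamma n w n = 0.
Proof. by rewrite /gamma bin_small ?mulr0 // prednK. Qed.

Lemma gamma_ge0 k : (k <= n)%N -> 0 <= gamma n w k.
Proof.
rewrite leq_eqVlt => /predU1P[->|lt_kn]; first by rewrite gamma_last.
exact/ltW/gamma_gt0.
Qed.

Lemma gamma_prev_ge0 k : (k <= n)%N -> 0 <= gamma_prev n w k.
Proof. by case: k => //= k lt_kn; apply/ltW/gamma_gt0. Qed.

Lemma node_den_gt0 k : (k <= n)%N -> 0 < gamma n w k + gamma_prev n w k.
Proof.
move=> le_kn; move: (le_kn); rewrite leq_eqVlt => /predU1P[eq_kn|lt_kn].
  rewrite ltr_wpDl ?gamma_ge0 // eq_kn.
  by case: n n_gt0 gamma_gt0 => //= m _ /(_ m (ltnSn m)).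
by rewrite ltr_pwDl ?gamma_gt0 ?gamma_prev_ge0.
Qed.

Lemma node_mul_den k : (k <= n)%N ->
  node n w k * (gamma n w k + gamma_prev n w k) = gamma_prev n w k.
Proof. by move=> le_kn; rewrite divfK // gt_eqF ?node_den_gt0. Qed.

Lemma node01 k : (k <= n)%N -> 0 <= node n w k <= 1.
Proof.
move=> le_kn; rewrite divr_ge0 ?gamma_prev_ge0 ?(ltW (node_den_gt0 _ _)) //=.
by rewrite ler_pdivrMr ?node_den_gt0 // mul1r lerDr gamma_ge0.
Qed.

Lemma node_first : node n w 0 = 0.
Proof. by rewrite /node mul0r. Qed.

Lemma node_last : node n w n = 1.
Proof.
have den_gt0 := node_den_gt0 n (leqnn n).
by move: den_gt0; rewrite /node gamma_last add0r => /gt_eqF/negbT/divff.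
Qed.

(** (W) is strict log-concavity of $\gamma$: the bound on its right-hand side is the
    ratio $\binom{n-1}{k}^2 / (\binom{n-1}{k-1} \binom{n-1}{k+1})$. *)
Lemma gamma_log_concave k : property_W n w -> (k.+2 < n)%N ->
  gamma n w k * gamma n w k.+2 <= gamma n w k.+1 ^+ 2.
Proof.
move=> wW lt_kn.
have lt_k1 : (1 <= k.+1 <= n - 2)%N.
  by rewrite /= leq_subRL ?(leq_trans _ lt_kn).
have := wW k.+1 lt_k1; rewrite /= -!subnDA addn1 -[n in (n - _)%N](prednK n_gt0).
rewrite -[n in (n - k.+2)%N](prednK n_gt0) !subSS /gamma.
have := congr1 (fun i => i%:R : R) (mul_bin_left n.-1 k).
have := congr1 (fun i => i%:R : R) (mul_bin_left n.-1 k.+1).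
have lt_k1n : (k.+1 < n.-1)%N by rewrite -ltnS prednK.
have : 0 < (n.-1 - k)%:R :> R by rewrite ltr0n subn_gt0 ltnW.
have : 0 < (n.-1 - k.+1)%:R :> R by rewrite ltr0n subn_gt0.
have : 0 < k.+1%:R :> R by rewrite ltr0n.
have : 0 < k.+2%:R :> R by rewrite ltr0n.
have : 0 < w k.+1 by rewrite w_gt0 // subn1 ltnW.
rewrite !natrM; move: (_ - k)%:R (_ - k.+1)%:R k.+1%:R k.+2%:R => s u p r.
move: 'C(_, k)%:R 'C(_, k.+1)%:R 'C(_, k.+2)%:R => c0 c1 c2.
move=> w1_gt0 r_gt0 p_gt0 u_gt0 s_gt0 bin2 bin1.
rewrite mulf_div ltr_pdivrMr ?exprn_gt0 // mulrAC ltr_pdivlMr ?mulr_gt0 // => W.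
rewrite -(ler_pM2r (mulr_gt0 r_gt0 s_gt0)).
have -> : w k * c0 * (w k.+2 * c2) * (r * s) =
  w k * w k.+2 * (s * c0) * (r * c2) by ring.
rewrite -bin1 bin2.
have -> : w k * w k.+2 * (p * c1) * (u * c1) =
  w k * w k.+2 * (p * u) * c1 ^+ 2 by ring.
have -> : (w k.+1 * c1) ^+ 2 * (r * s) = r * s * w k.+1 ^+ 2 * c1 ^+ 2 by ring.
by rewrite ler_wpM2r ?sqr_ge0 // ltW.
Qed.

Lemma node_mono k : property_W n w -> (k < n)%N -> node n w k <= node n w k.+1.
Proof.
move=> wW; case: k => [|k] lt_kn.
  by rewrite node_first; case/andP: (node01 1 lt_kn).
move: (lt_kn); rewrite leq_eqVlt => /predU1P[eq_kn|lt_k2n].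
  by rewrite eq_kn node_last; case/andP: (node01 k.+1 (ltnW lt_kn)).
rewrite /node ler_pdivrMr ?node_den_gt0 ?(ltnW lt_kn) // mulrAC.
rewrite ler_pdivlMr ?node_den_gt0 //=.
rewrite !mulrDr [_ * gamma n w k]mulrC lerD2r -expr2.
exact: gamma_log_concave.
Qed.

Lemma node_step_le_mesh k : (k < n)%N -> node n w k.+1 - node n w k <= mesh n w.
Proof.
move=> lt_kn; apply: le_trans (ler_norm _) _; apply: ub_le_sup; last first.
  by exists k => //=; rewrite subn1 -ltnS prednK.
exists 1 => _ [j /= le_jn <-].
have lt_jn : (j < n)%N by rewrite -(prednK n_gt0) ltnS -subn1.
have /andP[? ?] := node01 j (ltnW lt_jn); have /andP[? ?] := node01 j.+1 lt_jn.
by rewrite ler_norml; apply/andP; split; lra.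
Qed.

End Nodes.

(** * Moments of the operator *)

Section Moments.
Variables (R : realType) (n : nat) (Q : {poly R}) (w : nat -> R) (x : R).
Hypothesis n_gt0 : (0 < n)%N.
Hypothesis w_gt0 : forall k : nat, (k <= n - 1)%N -> 0 < w k.

(** The weights $q_k$: the terms of the expansion of $Q(x)$, divided by
    $Q(x)$. *)
Definition bernstein_weight k : R :=
  gamma n w k * (x ^+ k * (1 - x) ^+ (n - k.+1) / Q.[x]).

Lemma bernstein_weight_ge0 k :
  0 <= x <= 1 -> 0 < Q.[x] -> (k < n)%N -> 0 <= bernstein_weight k.
Proof.
case/andP=> x_ge0 x_le1 Qx_gt0 lt_kn.
rewrite /bernstein_weight mulr_ge0 ?(gamma_ge0 R n w n_gt0 w_gt0) ?(ltnW lt_kn) //.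
by rewrite divr_ge0 ?(ltW Qx_gt0) // mulr_ge0 // exprn_ge0 // subr_ge0.
Qed.

(** Both sides equal $\gamma_k (1 - x_{k+1}) x^{k+1} (1-x)^{n-k-1} / Q(x)$,
    because $x_{k+1}$ and $1 - x_{k+1}$ are in the ratio
    $\gamma_k : \gamma_{k+1}$. *)
Lemma bernstein_weight_balance k : (k.+1 < n)%N ->
  bernstein_weight k.+1 * node n w k.+1 * (1 - x) =
  bernstein_weight k * (1 - node n w k.+1) * x.
Proof.
move=> lt_kn; rewrite /bernstein_weight -(subnSK lt_kn) !exprS.
have /= node_den := node_mul_den R n w n_gt0 w_gt0 k.+1 (ltnW lt_kn).
have ratio : gamma n w k.+1 * node n w k.+1 = gamma n w k * (1 - node n w k.+1).
  by rewrite mulrBr mulr1 -[X in _ = X - _]node_den; ring.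
set p := x ^+ k; set r := (1 - x) ^+ _.
transitivity (gamma n w k.+1 * node n w k.+1 * (x * p * r * (1 - x) / Q.[x])).
  by ring.
by rewrite ratio; ring.
Qed.

(** Since $(x_k - x)(\gamma_k + \gamma_{k-1}) = (1-x) \gamma_{k-1} - x \gamma_k$,
    each term is a difference of two adjacent weights times $x(1-x)$; the
    boundary terms vanish by $\gamma_{-1} = \gamma_n = 0$. *)
Lemma rat_bernstein_mul_center (g : R -> R) :
  rat_bernstein n Q w (fun t => (t - x) * g t) x =
  x * (1 - x) *
    \sum_(k < n) bernstein_weight k * (g (node n w k.+1) - g (node n w k)).
Proof.
pose p k := x ^+ k * (1 - x) ^+ (n - k) / Q.[x].
have term (k : 'I_n.+1) :
    (node n w k - x) * g (node n w k) * (gamma n w k + gamma_prev n w k) * p k =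
    (1 - x) * gamma_prev n w k * g (node n w k) * p k -
    x * gamma n w k * g (node n w k) * p k.
  have le_kn : (k <= n)%N by rewrite -ltnS.
  have node_den := node_mul_den R n w n_gt0 w_gt0 k le_kn.
  transitivity ((node n w k * (gamma n w k + gamma_prev n w k) -
    x * (gamma n w k + gamma_prev n w k)) * g (node n w k) * p k); first by ring.
  by rewrite node_den; ring.
rewrite /rat_bernstein (eq_bigr _ (fun k _ => term k)) sumrB.
rewrite big_ord_recl big_ord_recr /= gamma_last // !(mulr0, mul0r) add0r addr0.
rewrite -sumrB mulr_sumr; apply: eq_bigr => k _.
rewrite /bernstein_weight /p /bump /= add1n.
by rewrite -(subnSK (ltn_ord k)) !exprS; ring.
Qed.

End Moments.

(** * The fourth moment *)

Theorem theorem13 (R : realType) (n : nat) (Q : {poly R}) (w : nat -> R)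
    (n_ge1 : (1 <= n)%N)
    (degQ : (size Q <= n)%N)
    (Q_gt0 : forall x : R, 0 <= x <= 1 -> 0 < Q.[x])
    (wQ : bernstein_coefs n Q w)
    (w_gt0 : forall k : nat, (k <= n - 1)%N -> 0 < w k)
    (wW : property_W n w) :
  forall x : R, 0 <= x <= 1 ->
    rat_bernstein n Q w (fun t => (t - x) ^+ 4) x
      <= mesh n w * rat_bernstein n Q w (fun t => (t - x) ^+ 2) x
         * (6 * x ^+ 2 - 15 * x + 12 + mesh n w).
Proof.
move=> x x01; case/andP: (x01) => x_ge0 x_le1.
pose q := bernstein_weight R n Q w x.
pose S := \sum_(k < n) q k * (node n w k.+1 - node n w k).
have moment2 : rat_bernstein n Q w (fun t => (t - x) ^+ 2) x = x * (1 - x) * S.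
  transitivity (rat_bernstein n Q w (fun t => (t - x) * (t - x)) x).
    by apply: eq_bigr => k _; rewrite expr2.
  rewrite rat_bernstein_mul_center //; congr (_ * _).
  by apply: eq_bigr => k _; congr (_ * _); ring.
have moment4 : rat_bernstein n Q w (fun t => (t - x) ^+ 4) x = x * (1 - x) *
    \sum_(k < n) q k * ((node n w k.+1 - x) ^+ 3 - (node n w k - x) ^+ 3).
  rewrite -(rat_bernstein_mul_center R n Q w x n_ge1 w_gt0 (fun t => (t - x) ^+ 3)).
  by apply: eq_bigr => k _; rewrite exprS.
have q_ge0 k : (k < n)%N -> 0 <= q k.
  exact: bernstein_weight_ge0 n_ge1 w_gt0 k x01 (Q_gt0 x x01).
have mono k : (k < n)%N -> node n w k <= node n w k.+1 by exact: node_mono.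
have step_le k : (k < n)%N -> node n w k.+1 - node n w k <= mesh n w.
  exact: node_step_le_mesh.
have mesh_ge0 : 0 <= mesh n w.
  by apply: le_trans (step_le 0%N n_ge1); rewrite subr_ge0 mono.
have xx_ge0 : 0 <= x * (1 - x) by rewrite mulr_ge0 // subr_ge0.
have S_ge0 : 0 <= S.
  by apply: sumr_ge0 => k _; rewrite mulr_ge0 ?q_ge0 // subr_ge0 mono.
have cube_le :
    \sum_(k < n) q k * ((node n w k.+1 - x) ^+ 3 - (node n w k - x) ^+ 3) <=
    mesh n w * S * (3 + mesh n w).
  have le_predn k : (k <= n.-1)%N = (k < n)%N by rewrite -ltnS prednK.
  have := sum_weighted_cube_le R x n.-1 (node n w) q x01 (node_first R n w).
  rewrite prednK //; apply => [|k|k|k|k|k]; rewrite ?le_predn.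
  - exact: node_last.
  - exact: node01.
  - exact: mono.
  - exact: q_ge0.
  - by move=> lt_k; apply: bernstein_weight_balance => //; rewrite -(prednK n_ge1).
  - exact: step_le.
rewrite moment2 moment4.
apply: le_trans (ler_wpM2l xx_ge0 cube_le) _.
have -> : x * (1 - x) * (mesh n w * S * (3 + mesh n w)) =
  mesh n w * (x * (1 - x) * S) * (3 + mesh n w) by ring.
rewrite ler_wpM2l ?(mulr_ge0 mesh_ge0 (mulr_ge0 xx_ge0 S_ge0)) // lerD2r -subr_ge0.
have -> : 6 * x ^+ 2 - 15 * x + 12 - 3 = 3 * ((1 - x) * (3 - 2 * x)) :> R by ring.
by rewrite !mulr_ge0 //; lra.
Qed.
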